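(* For $n>2$ and $1<k<n$, in $G=H_B(n,k)$: (1) the periphery $P(G)=\{v: e(v)=\mathrm{diam}(G)\}$ equals the set of all $r$-vertices of $V_2$ with $1\le r<n$; (2) the centre $C(G)=\{v: e(v)=\mathrm{rad}(G)\}$ equals the set of all $n$-vertices (which all lie in $V_2$).
   Context: Fix integers $n\ge 2$ and $1\le k<n$ and positive real numbers $x_1<x_2<\dots<x_n$. Let $\mathscr{B}_n=\{\pm x_1,\pm x_2,\dots,\pm x_{n-1},x_n\}$ (so $-x_n\notin\mathscr{B}_n$). Let $\phi(\mathscr{B}_n)$ be the family of all nonempty subsets $S\subseteq\mathscr{B}_n$ whose elements have pairwise distinct absolute values and whose element of largest absolute value is positive. Let $\mathscr{B}_n^+=\{x_1,\dots,x_n\}$, let $V_1$ be the set of all $k$-element subsets of $\mathscr{B}_n^+$, and let $V_2=\phi(\mathscr{B}_n)\setminus V_1$. For $A\in\phi(\mathscr{B}_n)$ put $A^\dagger=\{|a|:a\in A\}$. The bipartite Kneser B type-$k$ graph $H_B(n,k)$ is the simple graph with vertex set $V_1\cup V_2$ in which $X\in V_1$ and $Y\in V_2$ are adjacent if and only if $X\subseteq Y^\dagger$ or $Y^\dagger\subseteq X$, and there are no other edges. An $r$-vertex is a vertex having exactly $r$ elements. $e(v)$ denotes eccentricity. *)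

(* Defs.v *)
From HB Require Import structures.
From mathcomp Require Import all_boot.
Set Implicit Arguments. Unset Strict Implicit. Unset Printing Implicit Defensive.

(* Signed element (i, b) : 'I_n * bool encodes  x_(i+1)  if b = false and
   -x_(i+1) if b = true.  Since 0 < x_1 < ... < x_n, the absolute value of
   (i,b) is x_(i+1), and comparing absolute values = comparing indices. *)
Section HB.
Variables n k : nat.

Definition signed := ('I_n * bool)%type.

Definition phib (A : {set signed}) : bool :=
  [&& A != set0,
      (* only elements of B_n: -x_n is not allowed *)
      [forall p in A, (p.1 == n.-1 :> nat) ==> ~~ p.2],
      [forall p in A, forall q in A, (p.1 == q.1) ==> (p == q)] &
      [forall p in A, [forall q in A, q.1 <= p.1] ==> ~~ p.2]].

Definition vtx := {A : {set signed} | phib A}.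
HB.instance Definition _ := Finite.on vtx.

Definition dag (A : {set signed}) : {set 'I_n} := [set p.1 | p in A].

Definition inV1 (v : vtx) : bool :=
  [forall p in val v, ~~ p.2] && (#|val v| == k).
Definition inV2 (v : vtx) : bool := ~~ inV1 v.

Definition adjcond (X Y : vtx) : bool :=
  (dag (val X) \subset dag (val Y)) || (dag (val Y) \subset dag (val X)).

Definition adj (u v : vtx) : bool :=
  (inV1 u && inV2 v && adjcond u v) || (inV1 v && inV2 u && adjcond v u).

Fixpoint ball (u : vtx) (m : nat) : {set vtx} :=
  if m is m'.+1 then ball u m' :|: [set y | [exists x in ball u m', adj x y]]
  else [set u].

(* graph distance; #|{: vtx}|.+1 plays the role of infinity (unreachable) *)
Definition dist (u v : vtx) : nat :=
  find (fun m => v \in ball u m) (iota 0 #|{: vtx}|.+1).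

Definition ecc (u : vtx) : nat := \max_(v : vtx) dist u v.
Definition diam : nat := \max_(u : vtx) ecc u.
Definition rad : nat := \big[minn/#|{: vtx}|.+1]_(u : vtx) ecc u.

Definition periphery : {set vtx} := [set v | ecc v == diam].
Definition centre : {set vtx} := [set v | ecc v == rad].
End HB.

(* Main.v *)
Require Import Defs.
From mathcomp Require Import all_boot zify.

Set Implicit Arguments. Unset Strict Implicit. Unset Printing Implicit Defensive.

(* Edges only join V1 to V2, and adjacency only depends on the daggers being
   nested.  The vertex with dagger {1..n} lies in V2 and is adjacent to all of
   V1, while every vertex has a V1-vertex nested with it; this bounds the
   eccentricities by 2 (full vertices), 3 (V1) and 4 (other V2 vertices).
   For the lower bounds: from X in V1, the singleton {x_j} with j outside X^dagger
   is a V2 vertex not adjacent to X; from a non-full A in V2, the singleton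
   {x_j} with j outside A^dagger (if |A| >= k) or a signed vertex with dagger
   the complement of A^dagger (if |A| < k) lies in V2 and has no k-set nested
   with both, so by parity it is at distance at least 4. *)

Lemma subset_of_card (T : finType) (A : {set T}) m :
  m <= #|A| -> exists2 S : {set T}, S \subset A & #|S| = m.
Proof.
case/card_geqP=> s [uniq_s <- sA]; exists [set x in s].
  by apply/subsetP=> x; rewrite inE; apply: sA.
by rewrite cardsE; apply/card_uniqP.
Qed.

Lemma exists_notin (T : finType) (A : {set T}) : #|A| < #|T| -> exists j, j \notin A.
Proof.
move=> A_lt_T; have /card_gt0P [j] : 0 < #|~: A| by have := cardsC A; lia.
by rewrite inE; exists j.
Qed.

Definition nested (T : finType) (A B : {set T}) := (A \subset B) || (B \subset A).

Lemma nestedC (T : finType) (A B : {set T}) : nested A B = nested B A.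
Proof. exact: orbC. Qed.

Lemma exists_nested_card (T : finType) (A : {set T}) m :
  m <= #|T| -> exists2 S : {set T}, #|S| = m & nested S A.
Proof.
move=> m_le; case: (leqP m #|A|) => [m_le_A | lt_A_m].
  by have [S SA <-] := subset_of_card m_le_A; exists S; rewrite // /nested SA.
have [S' S'A' cardS'] : exists2 S' : {set T}, S' \subset ~: A & #|S'| = m - #|A|.
  by apply: subset_of_card; have := cardsC A; lia.
exists (A :|: S'); last by rewrite /nested subsetUl orbT.
have /eqP disjAS' : A :&: S' == set0 by rewrite setIC setI_eq0 disjoints_subset.
by rewrite cardsU disjAS' cards0 cardS'; lia.
Qed.

Lemma nested_single_notin (T : finType) (S A : {set T}) j :
  1 < #|S| <= #|A| -> j \notin A -> nested S A -> ~~ nested S [set j].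
Proof.
case/andP=> S_gt1 S_le_A jNA nSA; rewrite /nested negb_or.
apply/andP; split; first by apply/negP=> /subset_leq_card; rewrite cards1; lia.
rewrite sub1set; apply: contra jNA => jS.
case/orP: nSA => [/subsetP -> // | AS].
by have /eqP -> : A == S by rewrite eqEcard AS S_le_A.
Qed.

Lemma nested_setC (T : finType) (S A : {set T}) :
  0 < #|A| < #|S| -> #|S| < #|T| -> nested S A -> ~~ nested S (~: A).
Proof.
case/andP=> /card_gt0P [a aA] A_lt_S S_lt_T.
case/orP=> [/subset_leq_card | AS]; first by lia.
rewrite /nested negb_or; apply/andP; split.
  by apply/negP=> /subsetP /(_ a (subsetP AS a aA)); rewrite inE aA.
apply/negP=> ACS; have : [set: T] \subset S by rewrite -(setUCr A) subUset AS.
by rewrite subTset => /eqP ST; move: S_lt_T; rewrite ST cardsT ltnn.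
Qed.

Lemma bigmin_leq (I : eqType) (r : seq I) m (F : I -> nat) j :
  j \in r -> \big[minn/m]_(i <- r) F i <= F j.
Proof.
elim: r => // i r IHr; rewrite big_cons inE => /predU1P [-> | /IHr].
  exact: geq_minl.
exact: leq_trans (geq_minr _ _).
Qed.

Section Graph.
Variables n k : nat.
Local Notation V := (vtx n).
Local Notation adj := (adj k).
Local Notation ball := (ball k).
Implicit Types u v w x y : V.

Definition dagv v : {set 'I_n} := dag (val v).

Lemma card_dagv v : #|dagv v| = #|val v|.
Proof.
rewrite card_in_imset // => p q pv qv eq_pq.
have /and4P [_ _ /forall_inP /(_ p pv) /forall_inP /(_ q qv) /implyP uniq_abs _] := valP v.
by apply/eqP/uniq_abs/eqP.
Qed.

Lemma card_vtx_le v : #|val v| <= n.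
Proof. by rewrite -card_dagv -[X in _ <= X]card_ord max_card. Qed.

Lemma card_vtx_gt0 v : 0 < #|val v|.
Proof. by have /and4P [] := valP v; rewrite card_gt0. Qed.

Lemma adjE x y : adj x y = (inV1 k x != inV1 k y) && nested (dagv x) (dagv y).
Proof.
rewrite /adj /inV2 /adjcond.
by case: (inV1 k x); case: (inV1 k y); rewrite //= ?orbF // orbC.
Qed.

Lemma adj_side x y : adj x y -> inV1 k y = ~~ inV1 k x.
Proof. by rewrite adjE => /andP [/negbTE]; case: (inV1 k x); case: (inV1 k y). Qed.

Lemma ball0 u : u \in ball u 0.
Proof. exact: set11. Qed.

Lemma ball_step u m x y : x \in ball u m -> adj x y -> y \in ball u m.+1.
Proof. by move=> xu xy; rewrite /= !inE; apply/orP; right; apply/exists_inP; exists x. Qed.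

Lemma ballS u m x : x \in ball u m -> x \in ball u m.+1.
Proof. by rewrite /= inE => ->. Qed.

Lemma ball_leq u m d x : m <= d -> x \in ball u m -> x \in ball u d.
Proof. by move/subnKC <-; elim: (d - m) => [|e IHe] xu; rewrite ?addn0 ?addnS ?ballS ?IHe. Qed.

Lemma ballSP u m y :
  y \in ball u m.+1 -> y \in ball u m \/ exists2 x, x \in ball u m & adj x y.
Proof. by rewrite /= inE => /orP [-> | /[!inE] /exists_inP]; [left | right]. Qed.

Lemma ball1P u x : x \in ball u 1 -> x = u \/ adj u x.
Proof.
by case/ballSP => [| [y]]; rewrite /= inE => /eqP ->; [left | right].
Qed.

Lemma ball2_same u x :
  x \in ball u 2 -> inV1 k x = inV1 k u -> x = u \/ exists2 y, adj u y & adj y x.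
Proof.
case/ballSP => [/ball1P [-> | ux] | [y /ball1P [-> | uy] yx]] side_x.
- by left.
- by move: side_x; rewrite (adj_side ux); case: (inV1 k u).
- by move: side_x; rewrite (adj_side yx); case: (inV1 k u).
- by right; exists y.
Qed.

Lemma ball2_opp u x : x \in ball u 2 -> inV1 k x != inV1 k u -> adj u x.
Proof.
case/ballSP => [/ball1P [-> | //] | [y /ball1P [-> // | uy] yx]]; first by rewrite eqxx.
by rewrite (adj_side yx) (adj_side uy) negbK eqxx.
Qed.

Lemma ball3_same u x :
  x \in ball u 3 -> inV1 k x = inV1 k u -> x = u \/ exists2 y, adj u y & adj y x.
Proof.
case/ballSP => [/ball2_same // | [y yu yx] side_x]; right; exists y => //.
by apply: ball2_opp yu _; rewrite -side_x (adj_side yx); case: (inV1 k y).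
Qed.

Lemma dist_leq u v m : v \in ball u m -> dist k u v <= m.
Proof.
move=> vu; rewrite /dist; case: (ltnP m #|{: V}|.+1) => [m_lt | m_ge].
  rewrite leqNgt; apply/negP => /(before_find 0).
  by rewrite nth_iota // add0n vu.
apply: leq_trans m_ge.
by rewrite -[X in _ <= X](size_iota 0) find_size.
Qed.

Lemma dist_gt u v m : m <= #|{: V}| -> v \notin ball u m -> m < dist k u v.
Proof.
move=> m_le vNu; rewrite ltnNge; apply/negP => dist_le.
have dist_lt : dist k u v < #|{: V}|.+1 by apply: leq_ltn_trans dist_le _.
have found : has (fun d => v \in ball u d) (iota 0 #|{: V}|.+1).
  by rewrite has_find size_iota.
have := nth_find 0 found; rewrite nth_iota ?add0n; last exact: dist_lt.
by move/(ball_leq dist_le); rewrite (negbTE vNu).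
Qed.

Lemma ecc_leq u m : (forall v, v \in ball u m) -> ecc k u <= m.
Proof. by move=> cover; apply/bigmax_leqP => v _; apply: dist_leq. Qed.

Lemma ecc_gt u v m : m <= #|{: V}| -> v \notin ball u m -> m < ecc k u.
Proof. by move=> m_le /(dist_gt m_le) /leq_trans; apply; apply: leq_bigmax. Qed.

End Graph.

Section Vertices.
Variables n k : nat.
Local Notation V := (vtx n).
Implicit Types (v : V) (S B : {set 'I_n}).

Lemma phib_pos S : S != set0 -> phib [set (i, false) | i in S].
Proof.
case/set0Pn=> i iS; apply/and4P; split.
- by apply/set0Pn; exists (i, false); apply: imset_f.
- by apply/forall_inP=> _ /imsetP [j _ ->]; rewrite implybT.
- by apply/forall_inP=> _ /imsetP [j _ ->]; apply/forall_inP=> _ /imsetP [l _ ->] /=;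
    apply/implyP=> /eqP ->.
- by apply/forall_inP=> _ /imsetP [j _ ->]; rewrite implybT.
Qed.

Definition posv S (S0 : S != set0) : V := exist (fun A => phib A) _ (phib_pos S0).

Lemma dagv_posv S (S0 : S != set0) : dagv (posv S0) = S.
Proof.
apply/setP=> i; apply/imsetP/idP => [[_ /imsetP [j jS ->] ->] // | iS].
by exists (i, false); rewrite ?imset_f.
Qed.

Lemma card_posv S (S0 : S != set0) : #|val (posv S0)| = #|S|.
Proof. by rewrite -card_dagv dagv_posv. Qed.

Lemma inV1_posv S (S0 : S != set0) : inV1 k (posv S0) = (#|S| == k).
Proof.
rewrite /inV1 card_posv [[forall _ in _, _]](_ : _ = true) //.
by apply/forall_inP=> _ /imsetP [i _ ->].
Qed.

Lemma card_dagv_V1 v : inV1 k v -> #|dagv v| = k.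
Proof. by rewrite card_dagv => /andP [_ /eqP]. Qed.

Lemma set1_neq0 (j : 'I_n) : [set j] != set0.
Proof. by apply/set0Pn; exists j; rewrite set11. Qed.

Definition singlev (j : 'I_n) : V := posv (set1_neq0 j).

Lemma card_vtx_geq : n <= #|{: V}|.
Proof.
have inj_single : injective singlev.
  by move=> i j /(congr1 (@dagv n)); rewrite !dagv_posv; apply: set1_inj.
by rewrite -[X in X <= _]card_ord; apply: leq_card inj_single.
Qed.

(* Negating the element of smallest absolute value keeps the maximum positive. *)
Lemma phib_neg B (m c : 'I_n) :
  m \in B -> c \in B -> m < c -> phib [set (i, i == m) | i in B].
Proof.
move=> mB cB lt_mc; apply/and4P; split.
- by apply/set0Pn; exists (m, true); rewrite -[true](eqxx m) imset_f.
- apply/forall_inP=> _ /imsetP [i _ ->] /=; apply/implyP=> /eqP i_last.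
  by apply/negP=> /eqP i_m; move: (ltn_ord c) lt_mc; rewrite -i_m i_last; lia.
- by apply/forall_inP=> _ /imsetP [i _ ->]; apply/forall_inP=> _ /imsetP [j _ ->] /=;
    apply/implyP=> /eqP ->.
- apply/forall_inP=> _ /imsetP [i _ ->] /=; apply/implyP=> /forall_inP max_i.
  apply/negP=> /eqP i_m; have := max_i (c, c == m) (imset_f _ cB).
  by rewrite /= i_m leqNgt lt_mc.
Qed.

Lemma exists_V2_dagv B : 1 < #|B| -> exists2 v, dagv v = B & ~~ inV1 k v.
Proof.
have neg_vtx m c : m \in B -> c \in B -> m < c -> exists2 v, dagv v = B & ~~ inV1 k v.
  move=> mB cB lt_mc; exists (exist (fun A => phib A) _ (phib_neg mB cB lt_mc)).
    apply/setP=> i; apply/imsetP/idP => [[_ /imsetP [j jB ->] ->] // | iB].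
    by exists (i, i == m); rewrite ?imset_f.
  rewrite /inV1 negb_and; apply/orP; left; apply/negP.
  by move/forall_inP/(_ _ (imset_f _ mB)); rewrite eqxx.
case/card_gt1P=> a [b [aB bB /negP a_neq_b]].
case: (ltngtP a b) => [lt_ab | lt_ba | /val_inj eq_ab]; first exact: neg_vtx lt_ab.
  exact: neg_vtx lt_ba.
by case: a_neq_b; rewrite eq_ab.
Qed.

Lemma dagv_full v : #|val v| = n -> dagv v = setT.
Proof.
by move=> card_v; apply/eqP; rewrite eqEcard subsetT cardsT card_ord card_dagv card_v leqnn.
Qed.

Lemma exists_V1_nested v : 0 < k <= n -> exists2 X, inV1 k X & nested (dagv X) (dagv v).
Proof.
case/andP=> k_gt0 k_le_n.
have [S card_S nested_S] : exists2 S : {set 'I_n}, #|S| = k & nested S (dagv v).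
  by apply: exists_nested_card; rewrite card_ord.
have S0 : S != set0 by rewrite -card_gt0 card_S.
by exists (posv S0); rewrite ?inV1_posv ?card_S ?dagv_posv.
Qed.

End Vertices.

Section Eccentricity.
Variables n k : nat.
Hypotheses (n_gt2 : 2 < n) (k_gt1 : 1 < k) (k_lt_n : k < n).
Local Notation V := (vtx n).
Implicit Types u v w x X : V.

Let k_bounds : 0 < k <= n.
Proof. by apply/andP; split; lia. Qed.

Let three_le_card_vtx : 3 <= #|{: V}|.
Proof. by apply: leq_trans (card_vtx_geq n). Qed.

Lemma singlev_V2 (j : 'I_n) : inV1 k (singlev j) = false.
Proof. by rewrite inV1_posv cards1; apply/eqP; lia. Qed.

Lemma full_V2 v : #|val v| = n -> ~~ inV1 k v.
Proof. by move=> card_v; apply/negP=> /card_dagv_V1; rewrite card_dagv card_v; lia. Qed.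

Lemma exists_full_V2 : exists2 N : V, dagv N = setT & ~~ inV1 k N.
Proof.
have T0 : [set: 'I_n] != set0 by rewrite -card_gt0 cardsT card_ord; lia.
by exists (posv T0); rewrite ?dagv_posv // full_V2 // card_posv cardsT card_ord.
Qed.

Lemma full_ball_cover N w m :
  dagv N = setT -> ~~ inV1 k N -> N \in ball k w m -> forall v, v \in ball k w m.+2.
Proof.
move=> N_full N_V2 Nw v.
have N_adj X : inV1 k X -> adj k N X.
  by move=> X_V1; rewrite adjE (negbTE N_V2) X_V1 /nested N_full subsetT orbT.
case: (boolP (inV1 k v)) => [v_V1 | v_V2]; first exact/ballS/(ball_step Nw)/N_adj.
have [X X_V1 nested_Xv] := exists_V1_nested v k_bounds.
apply: ball_step (ball_step Nw (N_adj X X_V1)) _.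
by rewrite adjE X_V1 (negbTE v_V2).
Qed.

Lemma V2_notin_ball3 u w : ~~ inV1 k u -> ~~ inV1 k w ->
  (forall S : {set 'I_n}, #|S| = k -> nested S (dagv u) -> ~~ nested S (dagv w)) ->
  w \notin ball k u 3.
Proof.
move=> u_V2 w_V2 no_common.
apply/negP=> /ball3_same; rewrite (negbTE u_V2) (negbTE w_V2) => /(_ erefl).
case=> [w_u | [x ux xw]].
  have [X /card_dagv_V1 card_X nested_Xu] := exists_V1_nested u k_bounds.
  by move: (no_common _ card_X nested_Xu); rewrite w_u nested_Xu.
have x_V1 : inV1 k x by rewrite (adj_side ux) u_V2.
move: (no_common _ (card_dagv_V1 x_V1)); rewrite nestedC.
by move: ux xw; rewrite !adjE => /andP [_ ->] /andP [_ ->] /(_ isT).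
Qed.

Lemma ecc_V1 X : inV1 k X -> ecc k X = 3.
Proof.
move=> X_V1; have card_X := card_dagv_V1 X_V1.
apply/eqP; rewrite eqn_leq; apply/andP; split.
  have [N N_full N_V2] := exists_full_V2.
  apply/ecc_leq/(@full_ball_cover N X 1 N_full N_V2)/(ball_step (ball0 k X)).
  by rewrite adjE X_V1 N_V2 /nested N_full subsetT.
have [j jNX] : exists j, j \notin dagv X by apply: exists_notin; rewrite card_ord card_X.
apply: (ecc_gt (v := singlev j)); first exact: leq_trans three_le_card_vtx.
apply/negP=> /ball2_opp; rewrite X_V1 singlev_V2 => /(_ isT).
rewrite adjE dagv_posv => /andP [_]; apply/negP.
apply: nested_single_notin jNX _; first by rewrite card_X leqnn andbT.
by apply/orP; left.
Qed.

Lemma ecc_full v : #|val v| = n -> ecc k v = 2.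
Proof.
move=> card_v; have v_V2 := full_V2 card_v.
apply/eqP; rewrite eqn_leq; apply/andP; split.
  exact/ecc_leq/(full_ball_cover (dagv_full card_v) v_V2)/ball0.
have [j _] : exists j, j \in dagv v by apply/card_gt0P; rewrite card_dagv card_vtx_gt0.
apply: (ecc_gt (v := singlev j)); first exact: leq_trans three_le_card_vtx.
apply/negP=> /ball1P [single_v | ].
  by move: card_v; rewrite -single_v card_posv cards1; lia.
by rewrite adjE singlev_V2 (negbTE v_V2).
Qed.

Lemma ecc_V2_nonfull v : ~~ inV1 k v -> #|val v| < n -> ecc k v = 4.
Proof.
move=> v_V2 card_v; rewrite -card_dagv in card_v.
apply/eqP; rewrite eqn_leq; apply/andP; split.
  have [N N_full N_V2] := exists_full_V2.
  have [X X_V1 nested_Xv] := exists_V1_nested v k_bounds.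
  apply/ecc_leq/(@full_ball_cover N v 2 N_full N_V2).
  apply: ball_step (ball_step (ball0 k v) (_ : adj k v X)) _.
    by rewrite adjE X_V1 (negbTE v_V2) nestedC.
  by rewrite adjE X_V1 N_V2 /nested N_full subsetT.
have card_v_gt0 : 0 < #|dagv v| by rewrite card_dagv card_vtx_gt0.
case: (leqP k #|dagv v|) => [k_le_v | v_lt_k].
  have [j jNv] : exists j, j \notin dagv v by apply: exists_notin; rewrite card_ord.
  apply: (ecc_gt (v := singlev j) three_le_card_vtx).
  apply: V2_notin_ball3; rewrite ?singlev_V2 // => S card_S.
  by rewrite dagv_posv; apply: nested_single_notin jNv; rewrite card_S k_gt1.
have [w dagv_w w_V2] : exists2 w : V, dagv w = ~: dagv v & ~~ inV1 k w.
  by apply: exists_V2_dagv; have := cardsC (dagv v); rewrite card_ord; lia.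
apply: (ecc_gt (v := w) three_le_card_vtx).
apply: V2_notin_ball3; rewrite ?dagv_w // => S card_S.
by apply: nested_setC; rewrite card_S ?card_ord ?card_v_gt0 ?v_lt_k.
Qed.

Lemma ecc_val v : ecc k v = if inV1 k v then 3 else if #|val v| == n then 2 else 4.
Proof.
case: ifPn => [/ecc_V1 // | v_V2]; case: eqP => [/ecc_full // | card_v].
by apply: ecc_V2_nonfull; rewrite // ltn_neqAle card_vtx_le andbT; apply/eqP.
Qed.

Lemma diam_val : diam n k = 4.
Proof.
apply/eqP; rewrite eqn_leq; apply/andP; split.
  by apply/bigmax_leqP=> v _; rewrite ecc_val; case: ifP => //; case: ifP.
have j : 'I_n := Ordinal (ltnW (ltnW n_gt2)).
apply: leq_trans (leq_bigmax (singlev j)).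
by rewrite ecc_val singlev_V2 card_posv cards1; case: eqP => //; lia.
Qed.

Lemma rad_val : rad n k = 2.
Proof.
apply/eqP; rewrite eqn_leq; apply/andP; split.
  have [N N_full N_V2] := exists_full_V2.
  rewrite -(ecc_full (v := N)); last by rewrite -card_dagv N_full cardsT card_ord.
  exact/bigmin_leq/mem_index_enum.
apply: (big_ind (fun m => 1 < m)) => [|a b a_gt1 b_gt1|v _]; first by lia.
  by rewrite leq_min a_gt1.
by rewrite ecc_val; case: ifP => //; case: ifP.
Qed.

End Eccentricity.

Theorem mainTheorem14 (n k : nat) (hn : 2 < n) (hk1 : 1 < k) (hkn : k < n) :
  periphery n k = [set v : vtx n | inV2 k v & (1 <= #|val v| < n)] /\
  centre n k = [set v : vtx n | #|val v| == n] /\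
  (forall v : vtx n, #|val v| = n -> inV2 k v).
Proof.
have full_inV2 : forall v : vtx n, #|val v| = n -> inV2 k v by apply: full_V2.
split; [|split] => //; apply/setP=> v; rewrite !inE.
  rewrite diam_val ?ecc_val // card_vtx_gt0 /inV2 [_ < n]ltn_neqAle card_vtx_le andbT.
  by case: (inV1 k v); case: (#|val v| == n).
rewrite rad_val ?ecc_val //; case: ifP => [/card_dagv_V1 | _]; last by case: (#|val v| == n).
by rewrite card_dagv => ->; rewrite (ltn_eqF hkn).
Qed.
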